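(* Let $x_*$ be a locally optimal solution of the problem \[ (\mathcal{P}) \quad \text{minimize } f_0(x) = g_0(x) - h_0(x) \quad \text{subject to } F(x) = G(x) - H(x) \preceq_K 0, \quad x \in Q, \] and let the map $H$ be Fréchet differentiable at $x_*$. Then \[ \partial h_0(x_* ) \subseteq \partial g_0(x_* ) + N_{\Omega(x_* )}(x_* ), \] where $\Omega(x_* ) = \{ x \in Q \mid G(x) - H(x_* ) - D H(x_* )(x - x_* ) \preceq_K 0 \}$ and $DH(x_* )$ is the Fréchet derivative of $H$ at $x_*$.
   Context: $g_0, h_0 \colon \mathbb{R}^d \to \mathbb{R}$ are real-valued closed convex functions; $\partial$ denotes the subdifferential in the sense of convex analysis. $Y$ is a real Banach space and $K \subset Y$ is a proper cone, meaning a closed convex cone with $K \cap (-K) = \{0\}$; $x \preceq_K y$ iff $y - x \in K$. The maps $G, H \colon \mathbb{R}^d \to Y$ are $K$-convex: $G(\alpha x_1 + (1-\alpha)x_2) \preceq_K \alpha G(x_1) + (1-\alpha) G(x_2)$ for all $\alpha \in [0,1]$, $x_1, x_2 \in \mathbb{R}^d$, and similarly for $H$. $Q \subseteq \mathbb{R}^d$ is a closed convex set. For a convex set $V \subseteq \mathbb{R}^d$ and $x \in V$, $N_V(x) = \{ v \in \mathbb{R}^d \mid \langle v, z - x \rangle \le 0 \ \forall z \in V \}$ is the normal cone. *)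

(* Defs.v *)
From HB Require Import structures.
From mathcomp Require Import all_boot all_order all_algebra.
From mathcomp Require Import all_classical all_reals all_analysis.

Set Implicit Arguments.
Unset Strict Implicit.
Unset Printing Implicit Defensive.

Import Order.TTheory GRing.Theory Num.Theory.
Import numFieldNormedType.Exports.

Local Open Scope classical_set_scope.
Local Open Scope ring_scope.

(* R^d is modelled by row vectors, whose library norm is the sup norm; the
   notions below depend on it only through its topology, which is the
   Euclidean one. *)
Definition inner (R : realType) (d : nat) (u v : 'rV[R]_d) : R :=
  \sum_(i < d) u 0 i * v 0 i.

(* A convex function is closed when its epigraph is. *)
Definition closed_convex_function (R : realType) (d : nat)
    (f : 'rV[R]_d -> R) : Prop :=
  closed [set p : 'rV[R]_d * R | f p.1 <= p.2] /\
  convex_function [set: 'rV[R]_d] f.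

Definition subdifferential (R : realType) (d : nat) (f : 'rV[R]_d -> R)
    (x : 'rV[R]_d) : set 'rV[R]_d :=
  [set v | forall z, f x + inner v (z - x) <= f z].

Definition normal_cone (R : realType) (d : nat) (V : set 'rV[R]_d)
    (x : 'rV[R]_d) : set 'rV[R]_d :=
  [set v | forall z, V z -> inner v (z - x) <= 0].

Definition proper_cone (R : realType) (Y : normedModType R) (K : set Y) :
    Prop :=
  [/\ closed K,
      convex_set K,
      forall (t : R) (y : Y), 0 <= t -> K y -> K (t *: y) &
      K `&` [set - y | y in K] = [set 0]].

Definition cone_le (R : realType) (Y : normedModType R) (K : set Y)
    (x y : Y) : Prop := K (y - x).

Definition cone_convex (R : realType) (d : nat) (Y : normedModType R)
    (K : set Y) (G : 'rV[R]_d -> Y) : Prop :=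
  forall (a : R) (x1 x2 : 'rV[R]_d), 0 <= a <= 1 ->
    cone_le K (G (a *: x1 + (1 - a) *: x2)) (a *: G x1 + (1 - a) *: G x2).

Definition locally_optimal (R : realType) (d : nat) (f : 'rV[R]_d -> R)
    (S : set 'rV[R]_d) (x : 'rV[R]_d) : Prop :=
  S x /\ \forall z \near x, S z -> f x <= f z.

Definition feasible_set (R : realType) (d : nat) (Y : normedModType R)
    (K : set Y) (G H : 'rV[R]_d -> Y) (Q : set 'rV[R]_d) : set 'rV[R]_d :=
  [set x | Q x /\ cone_le K (G x - H x) 0].

Definition linearized_set (R : realType) (d : nat) (Y : normedModType R)
    (K : set Y) (G H : 'rV[R]_d -> Y) (Q : set 'rV[R]_d) (xs : 'rV[R]_d) :
    set 'rV[R]_d :=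
  [set x | Q x /\ cone_le K (G x - H xs - 'd H xs (x - xs)) 0].

(* Main.v *)
Require Import Defs.
From HB Require Import structures.
From mathcomp Require Import all_boot all_order all_algebra.
From mathcomp Require Import all_classical all_reals all_analysis.
From mathcomp Require Import ring lra.

Import Order.TTheory GRing.Theory Num.Theory.
Import numFieldNormedType.Exports.

Local Open Scope classical_set_scope.
Local Open Scope ring_scope.

(** Convexity of [H] puts its linearization at [xs] below [H], so the convex set
    [C = linearized_set K G H Q xs] lies in the feasible set. For [v] a
    subgradient of [h0] at [xs], the convex function [f = g0 - <v, .>] therefore
    has a local, hence global, minimum over [C] at [xs]. A subgradient at 0 of
    the finite convex function [phi w = inf_(c in C) f (w + c) - f xs] is then
    both a subgradient of [f] at [xs] and the opposite of a normal vector to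
    [C]. Subgradients of finite convex functions on R^d are built one coordinate
    at a time, as in the Hahn-Banach theorem. *)

(** * Convexity expressed with real weights *)

Lemma convex_functionP (R : realType) (E : lmodType R) (f : E -> R) :
  convex_function [set: E] f <->
  forall (a : R) (x y : E), 0 <= a <= 1 ->
    f (a *: x + (1 - a) *: y) <= a * f x + (1 - a) * f y.
Proof.
split=> [cf a x y /andP[a0 a1]|cf t x y _ _].
  by apply: (cf (Itv01 a0 a1) x y); rewrite inE.
by apply: cf; rewrite ge0 le1.
Qed.

Lemma convex_setP (R : realType) (E : lmodType R) (A : set E) :
  convex_set A <->
  forall (a : R) (x y : E), 0 <= a <= 1 -> A x -> A y ->
    A (a *: x + (1 - a) *: y).
Proof.
split=> [cA a x y /andP[a0 a1] Ax Ay|cA x y t].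
  by apply/set_mem; apply: (cA x y (Itv01 a0 a1)); rewrite inE.
by rewrite !inE => Ax Ay; apply: cA; rewrite ?ge0 ?le1.
Qed.

(** * Bilinearity of the inner product *)

Section inner_theory.
Context {R : realType} {d : nat}.
Implicit Types u v w : 'rV[R]_d.

Lemma innerC u v : inner u v = inner v u.
Proof. by apply: eq_bigr => i _; rewrite mulrC. Qed.

Lemma innerDr u v w : inner u (v + w) = inner u v + inner u w.
Proof. by rewrite -big_split; apply: eq_bigr => i _; rewrite mxE mulrDr. Qed.

Lemma innerZr a u v : inner u (a *: v) = a * inner u v.
Proof. by rewrite mulr_sumr; apply: eq_bigr => i _; rewrite mxE mulrCA. Qed.

Lemma innerNr u v : inner u (- v) = - inner u v.
Proof. by rewrite -scaleN1r innerZr mulN1r. Qed.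

Lemma innerDl u v w : inner (u + v) w = inner u w + inner v w.
Proof. by rewrite innerC innerDr !(innerC w). Qed.

Lemma innerZl a u v : inner (a *: u) v = a * inner u v.
Proof. by rewrite innerC innerZr innerC. Qed.

Lemma inner0r u : inner u 0 = 0.
Proof. by rewrite -(scale0r 0) innerZr mul0r. Qed.

Lemma inner_delta u k : inner u (delta_mx 0 k) = u 0 k.
Proof.
rewrite /inner (bigD1 k)//= big1 => [|i /negPf ik].
  by rewrite mxE !eqxx mulr1 addr0.
by rewrite mxE ik andbF mulr0.
Qed.

End inner_theory.

(** * Subgradients and minima of finite convex functions *)

Lemma exists_between (R : realType) (A B : set R) : A !=set0 -> B !=set0 ->
  (forall a b, A a -> B b -> a <= b) ->
  exists c, (forall a, A a -> a <= c) /\ (forall b, B b -> c <= b).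
Proof.
move=> A0 [b0 Bb0] AB; exists (sup A); split=> [a Aa|b Bb].
  by apply: ub_le_sup => //; exists b0 => a' Aa'; exact: AB.
by apply: ge_sup => // a Aa; exact: AB.
Qed.

(** A segment from [w - t *: e] to [w' + s *: e] meets [W], where [l <= phi]; convexity of [phi]
    then puts each lower bound on the slope below each upper bound, and [c] is chosen in between. *)
Lemma convex_extension_slope (R : realType) (E : lmodType R) (phi l : E -> R)
    (W : set E) (e : E) :
  convex_function [set: E] phi -> convex_set W -> W !=set0 ->
  (forall a x y, l (a *: x + (1 - a) *: y) = a * l x + (1 - a) * l y) ->
  (forall w, W w -> l w <= phi w) ->
  exists c, forall w t, W w -> l w + t * c <= phi (w + t *: e).
Proof.
move=> /convex_functionP cphi /convex_setP cW [w0 Ww0] lE lphi.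
(* [A] holds the lower bounds on [c] imposed by negative multiples of [e], [B] the upper bounds
   imposed by positive ones. *)
pose A := [set a | exists w t, [/\ W w, 0 < t & a = (l w - phi (w - t *: e)) / t]].
pose B := [set b | exists w t, [/\ W w, 0 < t & b = (phi (w + t *: e) - l w) / t]].
have [|||c [Ac Bc]] := @exists_between R A B.
- by exists ((l w0 - phi (w0 - 1 *: e)) / 1); exists w0, 1.
- by exists ((phi (w0 + 1 *: e) - l w0) / 1); exists w0, 1.
- move=> _ _ [w [t [Ww t0 ->]]] [w' [s [Ww' s0 ->]]].
  rewrite ler_pdivrMr// mulrAC ler_pdivlMr//.
  have ts0 : 0 < s + t by rewrite addr_gt0.
  (* This weight cancels the multiples of [e]: [a * (- t) + (1 - a) * s = 0]. *)
  pose a := s / (s + t).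
  have aE : 1 - a = t / (s + t) by rewrite /a; field; rewrite gt_eqF.
  have a01 : 0 <= a <= 1.
    by rewrite -(subr_ge0 a) aE /a !divr_ge0 // ltW.
  have := le_trans (lphi _ (cW a _ _ a01 Ww Ww')) _; rewrite lE.
  have -> : a *: w + (1 - a) *: w' =
      a *: (w - t *: e) + (1 - a) *: (w' + s *: e).
    rewrite scalerBr scalerDr !scalerA aE addrACA -scaleNr -scalerDl.
    by rewrite /a [X in X *: e](_ : _ = 0) ?scale0r ?addr0//; ring.
  move=> /(_ _ (cphi a _ _ a01)); rewrite aE /a.
  have -> p q : s / (s + t) * p + t / (s + t) * q = (s * p + t * q) / (s + t).
    by ring.
  have -> p q : s / (s + t) * p + t / (s + t) * q = (s * p + t * q) / (s + t).
    by ring.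
  by rewrite ler_pM2r ?invr_gt0//; lra.
exists c => w t Ww; have [t0|t0|->] := ltgtP t 0.
- have /Ac : A ((l w - phi (w - (- t) *: e)) / (- t)).
    by exists w, (- t); rewrite oppr_gt0.
  by rewrite ler_pdivrMr ?oppr_gt0// scaleNr opprK; lra.
- have /Bc : B ((phi (w + t *: e) - l w) / t) by exists w, t.
  by rewrite ler_pdivlMr//; lra.
- by rewrite mul0r scale0r !addr0; exact: lphi.
Qed.

(** Induction on the number [k] of coordinates allowed to be nonzero: [0 <= phi 0] starts it, and
    [convex_extension_slope] gains one coordinate. *)
Lemma convex_subgradient0 (R : realType) (d : nat) (phi : 'rV[R]_d -> R) :
  convex_function [set: 'rV[R]_d] phi -> 0 <= phi 0 ->
  exists u, forall z, inner u z <= phi z.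
Proof.
move=> cphi phi0.
suff H k : exists u : 'rV[R]_d, forall z : 'rV[R]_d, (forall i : 'I_d, (k <= i)%N -> z 0 i = 0) ->
      inner u z <= phi z.
  have [u hu] := H d; exists u => z; apply: hu => i.
  by rewrite ssrnat.leqNgt ltn_ord.
elim: k => [|k [u hu]].
  exists 0 => z z0; have -> : z = 0 by apply/rowP => i; rewrite z0 ?mxE.
  by rewrite inner0r.
have [kd|dk] := ltnP k d; last first.
  exists u => z _; apply: hu => i ki.
  by have := leq_trans dk ki; rewrite ssrnat.leqNgt ltn_ord.
pose e : 'rV[R]_d := delta_mx 0 (Ordinal kd).
pose W := [set z : 'rV[R]_d | forall i : 'I_d, (k <= i)%N -> z 0 i = 0].
have [|||c hc] := @convex_extension_slope _ _ phi (inner u) W e cphi _ _ _ hu.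
- apply/convex_setP => a x y _ Wx Wy i ki.
  by rewrite !mxE Wx// Wy// !mulr0 addr0.
- by exists 0 => i _; rewrite mxE.
- by move=> a x y; rewrite innerDr !innerZr.
(* The correction sets coordinate [k] of [u] to [c] and keeps the others. *)
exists (u + (c - u 0 (Ordinal kd)) *: e) => z zk.
pose r := z 0 (Ordinal kd).
have zE : z = (z - r *: e) + r *: e by rewrite subrK.
have Wz : W (z - r *: e).
  move=> i ki; rewrite !mxE eqxx /=.
  have [->|ik] := eqVneq i (Ordinal kd); first by rewrite mulr1 subrr.
  rewrite mulr0 subr0 zk// ltn_neqAle ki andbT.
  by apply: contra_neq ik => /esym ik; apply/val_inj.
rewrite [X in _ <= phi X]zE; apply: le_trans (hc _ r Wz).
rewrite innerDl innerZl (innerC e) innerDr innerNr innerZr !inner_delta -/r.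
by lra.
Qed.

(* With [f := g - <v, .>], this is the inclusion of the subdifferential of
   [g + indicator C] in the sum of the subdifferential of [g] and the normal
   cone; finiteness of [f] replaces the constraint qualification. *)
Lemma convex_min_multiplier (R : realType) (d : nat) (f : 'rV[R]_d -> R)
    (C : set 'rV[R]_d) (x : 'rV[R]_d) :
  convex_function [set: 'rV[R]_d] f -> convex_set C -> C x ->
  (forall z, C z -> f x <= f z) ->
  exists2 u, subdifferential f x u & normal_cone C x (- u).
Proof.
move=> /convex_functionP cf /convex_setP cC Cx fmin.
pose S (w : 'rV[R]_d) := [set f (w + c) | c in C].
have S0 w : S w !=set0 by exists (f (w + x)); exists x.
have half01 : 0 <= (2^-1 : R) <= 1 by lra.
(* The midpoint of [c] and [x] is also that of [w + c] and [x - w], so minimality of [x] and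
   convexity bound [f (w + c)] from below. *)
have lbS w : has_lbound (S w).
  exists (f x *+ 2 - f (x - w)) => _ [c Cc <-].
  have := le_trans (fmin _ (cC _ _ _ half01 Cc Cx)) _.
  have -> : 2^-1 *: c + (1 - 2^-1) *: x =
      2^-1 *: (w + c) + (1 - 2^-1) *: (x - w).
    have -> : 1 - 2^-1 = 2^-1 :> R by field.
    by rewrite -!scalerDr [in RHS]addrC addrA subrK addrC.
  by move=> /(_ _ (cf _ _ _ half01)); lra.
pose phi (w : 'rV[R]_d) := inf (S w) - f x.
have phile w c : C c -> phi w <= f (w + c) - f x.
  by move=> Cc; rewrite lerD2r; apply: ge_inf => //; exists c.
have phige w b : (forall c, C c -> b <= f (w + c) - f x) -> b <= phi w.
  move=> hb; rewrite lerBrDr; apply: lb_le_inf => // _ [c Cc <-].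
  by rewrite -lerBrDr; exact: hb.
have [||u hu] := @convex_subgradient0 _ _ phi.
- apply/convex_functionP => a w w' a01; have /andP[a0 a1] := a01.
  have [->|an0] := eqVneq a 0.
    by rewrite subr0 !scale0r !scale1r mul0r mul1r !add0r.
  have [->|an1] := eqVneq a 1.
    by rewrite subrr !scale0r !scale1r mul0r mul1r !addr0.
  have {an0}a0 : 0 < a by rewrite lt_neqAle eq_sym an0.
  have {an1}a1 : 0 < 1 - a by rewrite subr_gt0 lt_neqAle an1.
  (* Each infimum on the right is replaced in turn by its value at a point [c], then [c'], of [C];
     the one on the left is tested at [a *: c + (1 - a) *: c']. *)
  rewrite -lerBlDr -ler_pdivrMl//; apply: (phige) => c Cc.
  rewrite ler_pdivrMl// lerBlDr -lerBlDl -ler_pdivrMl//.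
  apply: (phige) => c' Cc'; rewrite ler_pdivrMl//.
  have := phile (a *: w + (1 - a) *: w') _ (cC a _ _ a01 Cc Cc').
  rewrite addrACA -!scalerDr => /le_trans h.
  have := h _ (lerD (cf _ _ _ a01) (lexx _)); lra.
- by apply: (phige) => c Cc; rewrite add0r subr_ge0 fmin.
(* Testing [phi (z - x)] at [x] gives the subgradient inequality; testing [phi (x - z)] at [z] in
   [C] gives normality. *)
exists u => z.
  by have := le_trans (hu (z - x)) (phile _ _ Cx); rewrite subrK; lra.
move=> Cz; rewrite innerC innerNr innerC -innerNr opprB.
by have := le_trans (hu (x - z)) (phile _ _ Cz); rewrite subrK subrr.
Qed.

(** Local minimality at [t *: z + (1 - t) *: x] for some small [t > 0], with convexity, gives
    [0 <= t * (f z - f x)]. *)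
Lemma convex_local_min (R : realType) (V : normedModType R) (f : V -> R)
    (C : set V) (x : V) :
  convex_function [set: V] f -> convex_set C -> C x ->
  (\forall z \near x, C z -> f x <= f z) ->
  forall z, C z -> f x <= f z.
Proof.
move=> /convex_functionP cf /convex_setP cC Cx fmin z Cz.
have cvgx : t *: z + (1 - t) *: x @[t --> (0 : R)^'+] --> x.
  apply: cvg_at_right_filter.
  rewrite -[X in _ --> X](_ : 0 *: z + (1 - 0) *: x = x); last first.
    by rewrite scale0r subr0 scale1r add0r.
  apply: cvgD; first by apply: cvgZr_tmp.
  apply: cvgZr_tmp; apply: cvgB => //; exact: cvg_cst.
have /filter_ex[t [[t0 t1] ft]] : \forall t \near (0 : R)^'+,
    (0 < t /\ t <= 1) /\ (C (t *: z + (1 - t) *: x) ->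
      f x <= f (t *: z + (1 - t) *: x)).
  near=> t; split.
    by split; near: t; [exact: nbhs_right_gt|exact: nbhs_right_le].
  by near: t; exact: (cvgx _ fmin).
have t01 : 0 <= t <= 1 by rewrite (ltW t0).
have := le_trans (ft (cC _ _ _ t01 Cz Cx)) (cf _ _ _ t01).
rewrite -subr_ge0 [X in 0 <= X](_ : _ = t * (f z - f x)); last by ring.
by rewrite pmulr_rge0// subr_ge0.
Unshelve. all: by end_near. Qed.

(** * Order and convexity with respect to a proper cone *)

Section cones.
Context {R : realType} {Y : normedModType R} (K : set Y) (hK : proper_cone K).

Lemma proper_cone0 : K 0.
Proof.
have [_ _ _ K0] := hK.
by have : [set (0 : Y)] 0 by []; rewrite -K0 => -[].
Qed.

Lemma proper_coneZ (t : R) (y : Y) : 0 <= t -> K y -> K (t *: y).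
Proof. by have [_ _ KZ _] := hK; exact: KZ. Qed.

(** A sum is twice a midpoint. *)
Lemma proper_coneD (x y : Y) : K x -> K y -> K (x + y).
Proof.
have [_ /convex_setP cK KZ _] := hK => Kx Ky.
have -> : x + y = 2 *: (2^-1 *: x + (1 - 2^-1) *: y).
  have -> : 1 - 2^-1 = 2^-1 :> R by field.
  by rewrite -scalerDr scalerA divff ?scale1r// pnatr_eq0.
by apply: KZ => //; apply: cK => //; lra.
Qed.

Lemma cone_convexB_affine (d : nat) (G l : 'rV[R]_d -> Y) :
  cone_convex K G ->
  (forall a x y, l (a *: x + (1 - a) *: y) = a *: l x + (1 - a) *: l y) ->
  cone_convex K (fun x => G x - l x).
Proof.
move=> cG lE a x y a01; rewrite /cone_le !scalerBr addrACA -opprD -lE.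
by rewrite opprB addrA subrK; exact: cG.
Qed.

Lemma cone_convex_sublevel (d : nat) (F : 'rV[R]_d -> Y) :
  cone_convex K F -> convex_set [set x | cone_le K (F x) 0].
Proof.
move=> cF; apply/convex_setP => a x y a01 Fx Fy.
have /andP[a0 a1] := a01; have {}a1 : 0 <= 1 - a by rewrite subr_ge0.
have := proper_coneD _ _ (proper_coneD _ _ (proper_coneZ _ _ a0 Fx)
  (proper_coneZ _ _ a1 Fy)) (cF a x y a01).
by rewrite /cone_le /= !sub0r !scalerN -opprD addrA addNr add0r.
Qed.

(** The convexity gap of [H] on the segment from [x] to [z], divided by [t], is [H z - H x] minus a
    difference quotient. It lies in the closed set [K], and so does its limit as [t] tends to 0 from
    the right. *)
Lemma cone_convex_diff_le (d : nat) (H : 'rV[R]_d -> Y) (x z : 'rV[R]_d) :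
  cone_convex K H -> differentiable H x ->
  cone_le K (H x + 'd H x (z - x)) (H z).
Proof.
move=> cH dH; rewrite /cone_le -deriveE//.
have [clK _ _ _] := hK.
apply: (@closed_cvg _ _ ((0 : R)^'+) _ _ _ clK _ _
  (cvgB (cvg_cst (H z)) (cvgD (cvg_cst (H x))
    (cvg_dnbhs_at_right (diff_derivable dH))))).
near=> t; rewrite !fctE.
have t0 : 0 < t by near: t; exact: nbhs_right_gt.
have t1 : t <= 1 by near: t; exact: nbhs_right_le.
have t01 : 0 <= t <= 1 by rewrite (ltW t0).
have ti0 : 0 <= t^-1 by rewrite invr_ge0 ltW.
have := proper_coneZ _ _ ti0 (cH t z x t01); congr (K _).
have -> : t *: z + (1 - t) *: x = t *: (z - x) + x.
  by rewrite scalerBl scale1r scalerBr addrA addrAC.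
set u := H (_ + _).
have -> : t *: H z + (1 - t) *: H x - u = t *: (H z - H x) - (u - H x).
  by rewrite scalerBl scale1r scalerBr opprB !addrA [_ + H x - _]addrAC.
by rewrite scalerBr scalerA mulVf ?gt_eqF// scale1r opprD addrA.
Unshelve. all: by end_near. Qed.

End cones.

Theorem corollary5 (R : realType) (d : nat) (Y : completeNormedModType R)
    (K : set Y) (g0 h0 : 'rV[R]_d -> R) (G H : 'rV[R]_d -> Y)
    (Q : set 'rV[R]_d) (xs : 'rV[R]_d)
    (hK : proper_cone K)
    (hg0 : closed_convex_function g0) (hh0 : closed_convex_function h0)
    (hG : cone_convex K G) (hH : cone_convex K H)
    (hQclosed : closed Q) (hQconvex : convex_set Q)
    (hopt : locally_optimal (fun x => g0 x - h0 x) (feasible_set K G H Q) xs)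
    (hdiff : differentiable H xs) :
  subdifferential h0 xs `<=`
    [set u + w | u in subdifferential g0 xs
               & w in normal_cone (linearized_set K G H Q xs) xs].
Proof.
move=> v hv; set C := linearized_set K G H Q xs.
have [[Qxs Fxs] locmin] := hopt.
have /convex_functionP cg := hg0.2.
pose f x := g0 x - inner v x.
have cf : convex_function [set: 'rV[R]_d] f.
  apply/convex_functionP => a x y /(cg a x y).
  by rewrite /f innerDr !innerZr; lra.
have Cxs : C xs by split=> //; rewrite subrr linear0 subr0.
pose l z := H xs + 'd H xs (z - xs).
have lE a x y : l (a *: x + (1 - a) *: y) = a *: l x + (1 - a) *: l y.
  rewrite /l; have -> : a *: x + (1 - a) *: y - xs =
      a *: (x - xs) + (1 - a) *: (y - xs).
    by rewrite !scalerBr addrACA -opprD -scalerDl (addrC a) subrK scale1r.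
  rewrite linearD !linearZ /= !scalerDr addrACA -scalerDl.
  by rewrite (addrC a) subrK scale1r.
have CE z : C z <-> Q z /\ cone_le K (G z - l z) 0.
  by rewrite /C /linearized_set /= -addrA -opprD.
have cC : convex_set C.
  have /convex_setP cQ := hQconvex.
  have /(cone_convex_sublevel K hK _) /convex_setP cF :=
    cone_convexB_affine K d G l hG lE.
  apply/convex_setP => a x y a01 /CE[Qx Fx] /CE[Qy Fy]; apply/CE.
  by split; [exact: cQ|exact: cF].
(* [G z - H z] is the sum of [G z - l z] and [l z - H z], both at most 0 in the cone order. *)
have CF z : C z -> feasible_set K G H Q z.
  move=> /CE[Qz Cz]; split=> //.
  have := proper_coneD K hK _ _ (cone_convex_diff_le K hK _ _ _ z hH hdiff) Cz.
  by rewrite /cone_le !sub0r !opprB addrA subrK.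
(* Near [xs], adding the subgradient inequality of [h0] to local optimality gives a local minimum of
   [f]. *)
have fmin : forall z, C z -> f xs <= f z.
  apply: convex_local_min => //; apply: filterS locmin => z hz /CF/hz.
  by have := hv z; rewrite /f innerDr innerNr; lra.
have [u hu nu] := @convex_min_multiplier _ _ f C xs cf cC Cxs fmin.
(* Adding [v] back turns a subgradient of [f] into one of [g0], and [v = (u + v) + (- u)]. *)
exists (u + v).
  move=> z; have := hu z.
  by rewrite /f innerDl innerDr innerNr (innerDr v) innerNr; lra.
by exists (- u) => //; rewrite addrAC subrr add0r.
Qed.
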